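(* For every integer $n\ge 1$, every (simple, finite) graph $G$ with $n$ vertices and no stable set of size three has a strong immersion of $K_{2\lfloor n/5\rfloor}$.
   Context: A stable set is a set of pairwise nonadjacent vertices. $K_m$ is the complete graph on $m$ vertices. A graph $G$ admits an immersion of a graph $H$ if there are an injection $\pi_1:V(H)\to V(G)$ and a map $\pi_2$ sending each edge $e=xy$ of $H$ to a path of $G$ with endpoints $\pi_1(x),\pi_1(y)$, such that paths assigned to distinct edges of $H$ are pairwise edge-disjoint. The immersion is strong if in addition, for every edge $e$ of $H$, the path $\pi_2(e)$ meets the set $\pi_1(V(H))$ only in its endpoints. *)

(* Defs.v *)
From mathcomp Require Import all_boot.

Set Implicit Arguments.
Unset Strict Implicit.
Unset Printing Implicit Defensive.

Record sgraph := SGraph {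
  vertex :> finType;
  adj : rel vertex;
  adj_sym : symmetric adj;
  adj_irr : irreflexive adj
}.

Definition stable (G : sgraph) (S : {set G}) : bool :=
  [forall x in S, forall y in S, ~~ adj x y].

Definition complete_rel (m : nat) : rel 'I_m := fun i j => i != j.

Lemma complete_rel_sym m : symmetric (@complete_rel m).
Proof. by move=> i j; rewrite /complete_rel eq_sym. Qed.

Lemma complete_rel_irr m : irreflexive (@complete_rel m).
Proof. by move=> i; rewrite /complete_rel eqxx. Qed.

Definition complete (m : nat) : sgraph :=
  SGraph (@complete_rel_sym m) (@complete_rel_irr m).

(* Edges are unordered: two-element sets of adjacent vertices. *)
Definition edges (G : sgraph) : {set {set G}} :=
  [set [set x; y] | x in G, y in G & adj x y].

(* A path is given by the sequence of its vertices, without repetition, listed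
   in either of its two directions; [ends] is the set of its endpoints. *)
Definition is_path (G : sgraph) (ends : {set G}) (s : seq G) : bool :=
  if s is x :: p then
    [&& path (@adj G) x p, uniq (x :: p) & [set x; last x p] == ends]
  else false.

Definition path_edges (G : sgraph) (s : seq G) : seq {set G} :=
  if s is x :: p then pairmap (fun u v => [set u; v]) x p else [::].

(* Only the values of [pi2] on the edges of [H] matter. *)
Definition is_immersion (H G : sgraph) (pi1 : H -> G) (pi2 : {set H} -> seq G)
    : Prop :=
  [/\ injective pi1,
      forall e, e \in edges H -> is_path (pi1 @: e) (pi2 e)
    & forall e f, e \in edges H -> f \in edges H -> e != f ->
        forall a, a \in path_edges (pi2 e) -> a \notin path_edges (pi2 f)].

Definition is_strong_immersion (H G : sgraph) (pi1 : H -> G)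
    (pi2 : {set H} -> seq G) : Prop :=
  is_immersion pi1 pi2 /\
  forall e, e \in edges H ->
    forall v, v \in pi2 e -> v \in codom pi1 -> v \in pi1 @: e.

Definition has_strong_immersion (H G : sgraph) : Prop :=
  exists (pi1 : H -> G) (pi2 : {set H} -> seq G), is_strong_immersion pi1 pi2.

(* Main.v *)
(* Induction on k = n / 5, in an edge-minimal graph G.  Minimality gives every
   edge xy a vertex adjacent to neither x nor y; hence either G is covered by two
   cliques, one of which is large enough, or G has an induced 5-cycle Q.  The
   nonneighbours of a vertex form a clique, so we may assume that there are fewer
   than 2k of them.  Delete Q = q1..q5, take an immersion with a set M of 2(k - 1)
   branch vertices in the rest U, and add q1 and q3 as branch vertices, joined by
   the path q1 q2 q3.  A vertex of U misses at most two vertices of Q, adjacent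
   ones, so b in M misses at most one of q1, q3; if it misses t, use a path
   b l w t with l in {q2, q4, q5} and w in U - M private to b.  Any w adjacent to
   t that does not miss both q4 and q5 is suitable.  The sets of vertices of U - M
   that miss both ends of three given edges of Q are disjoint, so after rotating Q
   at least two thirds of U - M are left, that is, at least 2(k - 1) vertices,
   enough to choose the vertices w injectively. *)
Require Import Defs.
From mathcomp Require Import all_boot zify.

Set Implicit Arguments.
Unset Strict Implicit.
Unset Printing Implicit Defensive.

(** * Injections that avoid prescribed values *)

(** List [A] with [Y2] first and [Y1] last. The first [#|P1|] places lie outside [Y1], the last
    [#|P2|] places outside [Y2], and the two stretches do not overlap. This chooses the private
    vertices of the detours to [q1] and [q3]. *)
Lemma two_sided_injection (T : finType) (A P1 P2 Y1 Y2 : {set T}) :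
    Y1 \subset A -> Y2 \subset A -> [disjoint Y1 & Y2] ->
    #|P1| + #|Y1| <= #|A| -> #|P2| + #|Y2| <= #|A| -> #|P1| + #|P2| <= #|A| ->
  exists f : T -> T,
    [/\ {in P1 :|: P2 &, injective f}, {in P1, forall x, f x \in A :\: Y1}
      & {in P2 :\: P1, forall x, f x \in A :\: Y2}].
Proof.
move=> sY1 sY2 dY h1 h2 h12.
(* Serve [P1] from the front of [s] and [P2] from its back. *)
pose s := enum Y2 ++ enum (A :\: (Y1 :|: Y2)) ++ enum Y1.
have cA : #|A :\: (Y1 :|: Y2)| + #|Y1| + #|Y2| = #|A|.
  have := cardsID (Y1 :|: Y2) A; have /setIidPr-> : Y1 :|: Y2 \subset A.
    by rewrite subUset sY1.
  have := cardsUI Y1 Y2.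
  by move: dY; rewrite -setI_eq0 => /eqP->; rewrite cards0; lia.
have szs : size s = #|A| by rewrite !size_cat -!cardE; lia.
have us : uniq s.
  rewrite !cat_uniq !enum_uniq /= andbT; apply/andP; split; apply/hasPn => x /=.
    rewrite mem_cat !mem_enum !inE => /orP[/andP[/norP[]] //|x1].
    by rewrite (disjointFr dY x1).
  by rewrite !mem_enum !inE => ->.
have sA x : x \in s -> x \in A.
  rewrite !mem_cat !mem_enum !inE => /or3P[/(subsetP sY2)|/andP[]|/(subsetP sY1)] //.
pose g x := if x \in P1 then index x (enum P1) else #|A| - (index x (enum P2)).+1.
have i1 x : x \in P1 -> index x (enum P1) < #|P1|.
  by move=> xP; rewrite cardE index_mem mem_enum.
have i2 x : x \in P2 -> index x (enum P2) < #|P2|.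
  by move=> xP; rewrite cardE index_mem mem_enum.
have gA x : x \in P1 :|: P2 -> g x < #|A|.
  rewrite inE /g; case: ifP => /= [/i1 + _|_ /i2]; lia.
have nthE x : x \in P1 :|: P2 -> nth x s (g x) \in A.
  by move=> /gA gx; apply/sA/mem_nth; rewrite szs.
exists (fun x => nth x s (g x)); split.
- move=> x y xP yP; rewrite (set_nth_default y) ?szs ?gA // => /eqP.
  rewrite nth_uniq ?szs ?gA // => /eqP; move: xP yP; rewrite !inE /g.
  case: ifP => x1; case: ifP => y1 /=.
  + by move=> _ _; apply: (@index_inj _ x); rewrite mem_enum.
  + by move=> _ /i2 + E; have := i1 _ x1; lia.
  + by move=> /i2 + _ E; have := i1 _ y1; lia.
  + move=> x2 y2 E; apply: (@index_inj _ x (enum P2)); rewrite ?mem_enum //.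
    by have := i2 _ x2; have := i2 _ y2; lia.
- move=> x x1; rewrite inE nthE ?inE ?x1 // andbT.
  have := us; rewrite {1}/s catA cat_uniq => /and3P[_ /hasPn{}us _].
  apply/negP => h; have := us (nth x s (g x)); rewrite mem_enum => /(_ h)/negP; apply.
  have szl : g x < size (enum Y2 ++ enum (A :\: (Y1 :|: Y2))).
    rewrite size_cat -!cardE /g x1; have := i1 _ x1; lia.
  by rewrite /s catA nth_cat szl mem_nth.
- move=> x /setDP[x2 x1]; rewrite inE nthE ?inE ?x2 ?orbT // andbT.
  have := us; rewrite {1}/s cat_uniq => /and3P[_ /hasPn{}us _].
  apply/negP => h; have gx : #|Y2| <= g x < #|A|.
    by rewrite /g (negbTE x1); have := i2 _ x2; lia.
  have := us (nth x s (g x)); rewrite /= mem_enum h.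
  have [g1 g2] := andP gx.
  rewrite /s nth_cat -cardE ltnNge g1 /= mem_nth; first by move=> /(_ isT).
  rewrite size_cat -!cardE; lia.
Qed.

(** * Clique immersions inside a vertex set *)

Definition edge_seq (T : finType) (x : T) (s : seq T) : seq {set T} :=
  pairmap (fun u v => [set u; v]) x s.

(** A graph is given by a relation and a vertex set, so that deleting edges or vertices leaves the
    type unchanged. *)
Definition alpha_le2 (T : finType) (e : rel T) (V : {set T}) : Prop :=
  forall x y z, x \in V -> y \in V -> z \in V -> x != y -> x != z -> y != z ->
  [|| e x y, e x z | e y z].

(* A strong immersion of [K_m] inside [V] with branch vertices [b 0 .. b m.-1];
   for [i < j < m] the path from [b i] to [b j] is [b i :: p i j]. *)
Definition clique_immersion (T : finType) (e : rel T) (V : {set T}) (m : nat)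
    (b : nat -> T) (p : nat -> nat -> seq T) : Prop :=
  [/\ {in gtn m &, injective b}, {in gtn m, forall i, b i \in V},
      forall i j, i < j < m ->
        [/\ path e (b i) (p i j), last (b i) (p i j) = b j, uniq (b i :: p i j),
            {subset p i j <= V}
          & forall r, r < m -> b r \in b i :: p i j -> r = i \/ r = j]
    & forall i j i' j' a, i < j < m -> i' < j' < m ->
        a \in edge_seq (b i) (p i j) -> a \in edge_seq (b i') (p i' j') ->
        i = i' /\ j = j'].

Definition has_clique_immersion (T : finType) (e : rel T) (V : {set T}) (m : nat)
  : Prop := exists b p, clique_immersion e V m b p.

Lemma eq_set2 (T : finType) (u v u' v' : T) :
  [set u; v] = [set u'; v'] -> u = u' /\ v = v' \/ u = v' /\ v = u'.
Proof.
move=> E.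
have : u \in [set u'; v'] by rewrite -E !inE eqxx.
have : v \in [set u'; v'] by rewrite -E !inE eqxx orbT.
have : u' \in [set u; v] by rewrite E !inE eqxx.
have : v' \in [set u; v] by rewrite E !inE eqxx orbT.
rewrite !inE => /orP[]/eqP-> /orP[]/eqP-> /orP[]/eqP E1 /orP[]/eqP E2; subst; auto.
Qed.

(** Single edges serve as the paths. An element of [T] is needed as a default even for [m = 0],
    because [b] is a total function. *)
Lemma clique_immersion_of_clique (T : finType) (e : rel T) (V K : {set T}) (m : nat) :
  0 < #|T| -> K \subset V -> m <= #|K| ->
  {in K &, forall x y, x != y -> e x y} -> has_clique_immersion e V m.
Proof.
move=> /card_gt0P[x0 _] KV mK eK.
pose b i := nth x0 (enum K) i.
have bK i : i < m -> b i \in K.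
  by move=> im; rewrite -mem_enum mem_nth // -cardE (leq_trans im).
have binj i j : i < m -> j < m -> b i = b j -> i = j.
  move=> im jm /eqP; rewrite nth_uniq ?enum_uniq -?cardE ?(leq_trans _ mK) //.
  by move/eqP.
have bneq i j : i < j < m -> b i != b j.
  move=> ij; apply/eqP => /binj E; suff: i = j by lia.
  by apply: E; lia.
exists b, (fun i j => [:: b j]); split.
- by move=> i j; rewrite !inE; apply: binj.
- by move=> i im; apply/(subsetP KV)/bK.
- move=> i j ij; have bij := bneq _ _ ij; split=> //=.
  + by rewrite eK ?bK //; lia.
  + by rewrite !inE bij.
  + by move=> z; rewrite inE => /eqP->; apply/(subsetP KV)/bK; lia.
  + move=> r rm; rewrite !inE => /orP[]/eqP/binj E; [left|right]; apply: E => //; lia.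
- move=> i j i' j' a ij ij'; rewrite !inE => /eqP-> /eqP/eq_set2[].
    by move=> [/binj E1 /binj E2]; split; [apply: E1|apply: E2]; lia.
  move=> [/binj E1 /binj E2]; have : i = j' by apply: E1; lia.
  have : j = i' by apply: E2; lia.
  lia.
Qed.

Lemma clique_immersion_sub (T : finType) (e e' : rel T) (V : {set T}) (m : nat) :
  subrel e e' -> has_clique_immersion e V m -> has_clique_immersion e' V m.
Proof.
move=> ee' [b [p [h1 h2 h3 h4]]]; exists b, p; split=> // i j /h3[? ? ? ? ?].
by split=> //; apply: sub_path ee' _ _ _.
Qed.

Definition induced_C5 (T : finType) (e : rel T) (q1 q2 q3 q4 q5 : T) : bool :=
  [&& uniq [:: q1; q2; q3; q4; q5],
      [&& e q1 q2, e q2 q3, e q3 q4, e q4 q5 & e q5 q1] &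
      [&& ~~ e q1 q3, ~~ e q2 q4, ~~ e q3 q5, ~~ e q4 q1 & ~~ e q5 q2]].

Lemma induced_C5_rot (T : finType) (e : rel T) (q1 q2 q3 q4 q5 : T) :
  induced_C5 e q1 q2 q3 q4 q5 -> induced_C5 e q2 q3 q4 q5 q1.
Proof.
case/and3P=> u /and5P[e1 e2 e3 e4 e5] /and5P[n1 n2 n3 n4 n5].
rewrite /induced_C5 e1 e2 e3 e4 e5 n1 n2 n3 n4 n5 !andbT.
by rewrite -[[:: q2; _; _; _; _]]/(rot 1 [:: q1; q2; q3; q4; q5]) rot_uniq u.
Qed.

(** * Adding two vertices of an induced 5-cycle as branch vertices *)

Section Extension.

Variables (T : finType) (e : rel T) (V U : {set T}) (q1 q2 q3 q4 q5 : T).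
Variables (m : nat) (b : nat -> T) (p : nat -> nat -> seq T).
Hypotheses (esym : symmetric e) (alphaV : alpha_le2 e V) (UV : U \subset V).
Hypothesis qV : {subset [:: q1; q2; q3; q4; q5] <= V}.
Hypothesis qU : {in [:: q1; q2; q3; q4; q5], forall q, q \notin U}.
Hypothesis C5 : induced_C5 e q1 q2 q3 q4 q5.
Hypothesis imm : clique_immersion e U m b p.

Let M := [set b i | i : 'I_m].
(** The candidates for private vertices. A vertex missing both [q4] and [q5] could be reached only
    through [q2]. *)
Let A := [set x in U | (x \notin M) && (e x q4 || e x q5)].

Hypothesis cA : m <= #|A|.
Hypothesis c1 : #|[set x in U | ~~ e x q1]| <= #|A|.
Hypothesis c3 : #|[set x in U | ~~ e x q3]| <= #|A|.

(** Otherwise [x], [q], [q'] would form a stable triple in [V]. *)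
Let C5_missing x q q' : x \in U -> q \in [:: q1; q2; q3; q4; q5] ->
  q' \in [:: q1; q2; q3; q4; q5] -> q != q' -> ~~ e q q' -> e x q || e x q'.
Proof.
move=> xU qQ qQ' qq' nqq'.
have := alphaV (subsetP UV _ xU) (qV qQ) (qV qQ').
rewrite (negbTE nqq') orbF; apply=> //.
  by apply: contraTneq xU => ->; apply: qU.
by apply: contraTneq xU => ->; apply: qU.
Qed.

Let hub x y := if e x q2 && e q2 y then q2 else if e x q4 && e q4 y then q4 else q5.

Let hubE x y : hub x y \in [:: q2; q4; q5].
Proof. by rewrite /hub; case: ifP; [|case: ifP]; rewrite !inE eqxx ?orbT. Qed.

Let missing13 x : x \in U -> e x q1 || e x q3.
Proof.
move=> xU; have /and3P[u _ /and5P[n13 _ _ _ _]] := C5.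
have d13 : q1 != q3.
  by apply: contraTneq u => <-; rewrite /= !inE eqxx orbT.
by apply: C5_missing; rewrite ?inE ?eqxx ?orbT.
Qed.

(** Each of [x] and [y] misses at most one of [q2], [q4], [q5], so one of the three is adjacent to
    both. Vertices of the cycle missed by the same vertex are pairwise adjacent: if [x] misses [q1],
    it sees [q4] and one of [q2], [q5]; if it misses [q3], it sees [q5] and one of [q2], [q4]. For
    [y], only the pair [q4], [q5] could be missed, and [A] excludes it. *)
Let hubP x y : x \in U -> y \in A -> ~~ e x q1 || ~~ e x q3 ->
  e x (hub x y) && e (hub x y) y.
Proof.
move=> xU; rewrite !inE => /and3P[yU _ y45] nx.
have /and3P[u _ /and5P[n13 n24 n35 n41 n52]] := C5.
move: u; rewrite /= !inE !negb_or -!andbA.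
case/and5P=> d12 d13 d14 d15 /and5P[d23 d24 d25 d34 /and3P[d35 d45 _]].
have mis := fun z zU => @C5_missing z _ _ zU.
have [x14 x24 x35 x25] : [/\ e x q1 || e x q4, e x q2 || e x q4, e x q3 || e x q5
   & e x q2 || e x q5].
  by split; apply: C5_missing; rewrite ?inE ?eqxx ?orbT // esym.
have [y24 y25] : e y q2 || e y q4 /\ e y q2 || e y q5.
  by split; apply: C5_missing; rewrite ?inE ?eqxx ?orbT // esym.
have x13 := missing13 xU.
rewrite /hub !(esym _ y); move: nx x13 x14 x24 x35 x25 y24 y25 y45.
case E1: (e x q1); case E2: (e x q2); case E3: (e x q3); case E4: (e x q4);
case E5: (e x q5); case F2: (e y q2); case F4: (e y q4); case F5: (e y q5);
by rewrite /= ?E1 ?E2 ?E3 ?E4 ?E5 ?F2 ?F4 ?F5.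
Qed.

(** Edge-disjointness comes from counting ends in [U]: edges of old paths have two, edges of
    [q1 q2 q3] none, all other edges exactly one. For the last kind, the end in [U] determines the
    old branch vertex, since [f] is injective on the branch vertices that need a detour and its
    values there are not branch vertices; the other end determines the new branch vertex. *)
Lemma clique_immersion_extend : has_clique_immersion e V m.+2.
Proof.
have [binj bU pP pdisj] := imm.
have /and3P[uq /and5P[e12 e23 _ _ _] /and5P[n13 _ _ _ _]] := C5.
move: uq; rewrite /= !inE !negb_or -!andbA.
case/and5P=> d12 d13 d14 d15 /and5P[d23 d24 d25 d34 /and3P[d35 d45 _]].
have bM i : i < m -> b i \in M by move=> im; apply/imsetP; exists (Ordinal im).
have MP x : x \in M -> exists2 i, i < m & x = b i.
  by case/imsetP=> i _ ->; exists i.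
have MU x : x \in M -> x \in U by case/MP=> i /bU ? ->.
(* [P1] and [P3] hold the branch vertices that need a detour to [q1] and to [q3]; [Y1] and [Y3] hold
   the candidates useless for these detours. *)
pose P1 := [set x in M | ~~ e x q1]; pose P3 := [set x in M | ~~ e x q3].
pose Y1 := [set x in A | ~~ e x q1]; pose Y3 := [set x in A | ~~ e x q3].
have cPY q : #|[set x in M | ~~ e x q]| + #|[set x in A | ~~ e x q]| <=
             #|[set x in U | ~~ e x q]|.
  have E0 : [set x in M | ~~ e x q] :&: [set x in A | ~~ e x q] = set0.
    by apply/setP=> x; rewrite !inE; case: (x \in M); rewrite /= ?andbF.
  rewrite -cardsUI E0 cards0 addn0; apply/subset_leq_card/subsetP=> x.
  rewrite !inE => /orP[/andP[/MU-> ->] //|/andP[/andP[-> _] ->] //].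
have disj13 (B : {set T}) : B \subset U ->
    [disjoint [set x in B | ~~ e x q1] & [set x in B | ~~ e x q3]].
  move=> BU; rewrite -setI_eq0; apply/eqP/setP=> x; rewrite !inE.
  case xB: (x \in B) => //=; have := missing13 (subsetP BU _ xB).
  by case: (e x q1); case: (e x q3).
have AU : A \subset U by apply/subsetP=> x; rewrite inE => /andP[].
have sMU : M \subset U by apply/subsetP.
have cP : #|P1| + #|P3| <= #|A|.
  apply: leq_trans cA; rewrite -cardsUI.
  have /eqP-> : P1 :&: P3 == set0 by rewrite setI_eq0 disj13.
  rewrite cards0 addn0; apply: (@leq_trans #|M|).
    by apply/subset_leq_card/subsetP=> x; rewrite !inE => /orP[]/andP[].
  by apply: leq_trans (leq_imset_card _ _) _; rewrite card_ord.
have [||||||f [finj f1 f3]] := @two_sided_injection T A P1 P3 Y1 Y3.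
- by apply/subsetP=> x; rewrite !inE => /andP[].
- by apply/subsetP=> x; rewrite !inE => /andP[].
- exact: disj13.
- exact: leq_trans (cPY q1) c1.
- exact: leq_trans (cPY q3) c3.
- exact: cP.
pose b' i := if i < m then b i else if i == m then q1 else q3.
pose l x := hub x (f x).
(* For [i < j < m.+2] the final alternative occurs only at [i = m], [j = m.+1], for the path
   [q1 q2 q3]. *)
pose p' i j := if j < m then p i j else if i < m then
   (if e (b i) (b' j) then [:: b' j] else [:: l (b i); f (b i); b' j])
   else [:: q2; q3].
have b'U i : i < m -> b' i = b i by rewrite /b' => ->.
have b'Q j : m <= j -> b' j = q1 \/ b' j = q3.
  by rewrite /b' ltnNge => ->; case: eqP; auto.
have [q1U q2U q3U q4U q5U] : [/\ q1 \notin U, q2 \notin U, q3 \notin U,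
    q4 \notin U & q5 \notin U].
  by split; apply: qU; rewrite !inE eqxx ?orbT.
have b'nU j : m <= j -> b' j \notin U by case/b'Q=> ->.
have b'm j : j < m.+2 -> [\/ j < m, j = m | j = m.+1].
  by move=> jm; case: (ltngtP j m) => b0; [constructor 1|constructor 3; clear -jm b0; lia|constructor 2].
have b'mE : b' m = q1 by rewrite /b' ltnn eqxx.
have b'm1E : b' m.+1 = q3 by rewrite /b' ltnNge leqnSn eqn_leq ltnn.
have b'inj i j : i < m.+2 -> j < m.+2 -> b' i = b' j -> i = j.
  move=> /b'm[im|->|->] /b'm[jm|->|->]; rewrite ?b'mE ?b'm1E ?b'U //.
  - by apply: binj.
  - by move=> E; move: q1U; rewrite -E bU.
  - by move=> E; move: q3U; rewrite -E bU.
  - by move=> E; move: q1U; rewrite E bU.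
  - by move=> E; move: d13; rewrite E eqxx.
  - by move=> E; move: q3U; rewrite E bU.
  - by move=> E; move: d13; rewrite E eqxx.
have b'V i : i < m.+2 -> b' i \in V.
  case/b'm=> [im|->|->]; rewrite ?b'mE ?b'm1E.
  - by rewrite b'U //; apply/(subsetP UV)/bU.
  - by apply: qV; rewrite !inE eqxx.
  - by apply: qV; rewrite !inE eqxx ?orbT.
have lQ x : [&& l x \notin U, l x \in V, l x != q1 & l x != q3].
  have := hubE x (f x); rewrite -/(l x) !inE => /or3P[]/eqP->.
  - by rewrite q2U qV ?inE ?eqxx ?orbT // eq_sym d12 d23.
  - by rewrite q4U qV ?inE ?eqxx ?orbT // eq_sym d14 eq_sym d34.
  - by rewrite q5U qV ?inE ?eqxx ?orbT // eq_sym d15 eq_sym d35.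
have lb' x r : m <= r -> l x != b' r.
  by move=> /b'Q; case/and4P: (lQ x) => _ _ ? ? [] ->.
have detour i j : i < m -> m <= j -> ~~ e (b i) (b' j) ->
    [/\ b i \in P1 :|: P3, f (b i) \in A, e (b i) (l (b i)), e (l (b i)) (f (b i))
      & e (f (b i)) (b' j)].
  move=> im mj nij.
  have [bP fA fe] : [/\ b i \in P1 :|: P3, f (b i) \in A & e (f (b i)) (b' j)].
    move: nij; case: (b'Q j mj) => -> nij.
      have bP : b i \in P1 by rewrite inE bM.
      have := f1 _ bP; rewrite !(inE, bM) // nij.
      by case: (e (f (b i)) q1); rewrite /= ?andbT ?andNb // => /andP[].
    have bP : b i \in P3 by rewrite inE bM.
    (* The vertex misses [q3], hence sees [q1]; so [f3] applies to it. *)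
    have nP1 : b i \notin P1.
      by rewrite inE bM //=; have := missing13 (bU _ im); rewrite (negbTE nij) orbF => ->.
    have /f3 : b i \in P3 :\: P1 by rewrite inE bP nP1.
    rewrite !(inE, bM) // nij orbT.
    by case: (e (f (b i)) q3); rewrite /= ?andbT ?andNb // => /andP[].
  have : ~~ e (b i) q1 || ~~ e (b i) q3 by case: (b'Q j mj) nij => -> ->; rewrite ?orbT.
  by move=> /(hubP (bU _ im) fA)/andP[].
have AP x : x \in A -> x \in U /\ forall r, r < m -> x != b r.
  rewrite inE => /and3P[xU xM _]; split=> // r rm.
  by apply: contraNneq xM => ->; apply: bM.
(* The disjunction separates the edge at [b i] from the two detour edges at the private vertex
   [f (b i)]. *)
have new_edges i j a : i < m -> m <= j -> a \in edge_seq (b' i) (p' i j) ->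
    exists u q, [/\ a = [set u; q], u \in U, q \notin U
     & (u = b i /\ (q = b' j \/ q = l (b i) /\ ~~ e (b i) (b' j))) \/
       [/\ u = f (b i), ~~ e (b i) (b' j) & q = b' j \/ q = l (b i)]].
  move=> im mj; rewrite /p' ltnNge mj im /= b'U //; case: ifPn => eij.
    rewrite !inE => /eqP->; exists (b i), (b' j).
    by split=> //; [apply: bU | apply: b'nU | left; split; last left].
  have [_ /AP[fU _] _ _ _] := detour _ _ im mj eij.
  have [lU _ _ _] := and4P (lQ (b i)).
  rewrite !inE => /or3P[]/eqP->.
  - exists (b i), (l (b i)).
    by split=> //; [apply: bU | left; split; last right].
  - exists (f (b i)), (l (b i)); rewrite setUC.
    by split=> //; right; split=> //; right.
  - exists (f (b i)), (b' j).
    by split=> //; [apply: b'nU | right; split=> //; left].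
have last_edges i j a : m <= i -> i < j < m.+2 -> a \in edge_seq (b' i) (p' i j) ->
    {in a, forall x, x \notin U}.
  move=> mi ij; have [-> ->] : i = m /\ j = m.+1 by clear -mi ij; lia.
  rewrite /p' ltnNge leqnSn ltnn b'mE !inE => /orP[]/eqP-> x;
  by rewrite !inE => /orP[]/eqP->.
have old_edges i j a : j < m -> i < j -> a \in edge_seq (b' i) (p' i j) ->
    {in a, forall x, x \in U}.
  move=> jm ij; rewrite /p' jm b'U; last exact: ltn_trans jm.
  have := pP i j; rewrite ij jm => /(_ isT)[_ _ _ sU _].
  have : b i \in U by apply: bU; apply: ltn_trans jm.
  elim: (p i j) (b i) sU => //= y s IHs x sU xU.
  have yU : y \in U by apply: sU; rewrite inE eqxx.
  rewrite inE => /orP[/eqP->|].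
    by move=> z; rewrite !inE => /orP[]/eqP->.
  by apply: IHs => // z zs; apply: sU; rewrite inE zs orbT.
have set2l (u v : T) : u \in [set u; v] by rewrite !inE eqxx.
have set2r (u v : T) : v \in [set u; v] by rewrite !inE eqxx orbT.
exists b', p'; split.
- by move=> i j; rewrite !inE; apply: b'inj.
- by move=> i; apply: b'V.
- move=> i j /andP[ij jm2]; case: (ltnP j m) => jm.
    have im := ltn_trans ij jm.
    have := pP i j; rewrite ij jm => /(_ isT)[h1 h2 h3 h4 h5].
    rewrite /p' jm !b'U //; split=> //.
      by move=> z /h4; apply: (subsetP UV).
    move=> r /b'm[rm|->|->]; rewrite ?b'mE ?b'm1E ?b'U //; first exact: h5.
      by rewrite inE => /orP[/eqP E|/h4]; [move: q1U; rewrite E bU | rewrite (negbTE q1U)].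
    by rewrite inE => /orP[/eqP E|/h4]; [move: q3U; rewrite E bU | rewrite (negbTE q3U)].
  case: (ltnP i m) => im.
    have bij r : r < m.+2 -> b i == b' r -> r = i.
      by move=> r2; rewrite -(b'U i) // => /eqP/b'inj-> //; apply: ltn_trans jm2.
    have bib'j : b i != b' j.
      by apply: contraTneq (bU _ im) => ->; apply: b'nU.
    rewrite /p' ltnNge jm im /= b'U //; case: ifPn => [eij|/(detour _ _ im jm)].
      split=> //=; rewrite ?eij ?inE ?bib'j //.
        by move=> z; rewrite inE => /eqP->; apply: b'V.
      move=> r r2; rewrite !inE => /orP[]; rewrite eq_sym; first by move/(bij _ r2); left.
      by move=> /eqP/b'inj-> //; right.
    case=> _ /AP[fU fb] e1 e2 e3; have [lU lV l1 l3] := and4P (lQ (b i)).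
    have fb' r : f (b i) != b' r.
      case: (ltnP r m) => rm; first by rewrite b'U // fb.
      by apply: contraTneq fU => ->; apply: b'nU.
    have lb r : l (b i) != b' r.
      case: (ltnP r m) => rm; last exact: lb'.
      by rewrite b'U //; apply: contraNneq lU => ->; apply: bU.
    split; rewrite //= ?e1 ?e2 ?e3 //.
    + have bl : b i != l (b i) by have := lb i; rewrite b'U // eq_sym.
      have lf : l (b i) != f (b i) by apply: contraNneq lU => ->.
      by rewrite !inE !negb_or bl lf bib'j fb' lb eq_sym fb.
    + move=> z; rewrite !inE => /or3P[]/eqP-> //; last exact: b'V.
      exact: (subsetP UV).
    + move=> r r2; rewrite !inE !(eq_sym (b' r)) (negbTE (lb r)) (negbTE (fb' r)) /=.
      by case/orP=> [/(bij _ r2)|/eqP/b'inj->]; auto.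
  have [-> ->] : i = m /\ j = m.+1 by clear -im ij jm2; lia.
  rewrite /p' ltnNge leqnSn ltnn b'mE b'm1E /=; split=> //.
  + by rewrite e12 e23.
  + by rewrite /= !inE negb_or d12 d13 d23.
  + by move=> z; rewrite !inE => /orP[]/eqP->; apply: qV; rewrite !inE eqxx ?orbT.
  + move=> r /b'm[rm|->|->]; auto; rewrite b'U // !inE => /or3P[]/eqP E.
    * by move: q1U; rewrite -E bU.
    * by move: q2U; rewrite -E bU.
    * by move: q3U; rewrite -E bU.
(* An edge is nonempty, so it cannot lie both inside [U] and outside [U]. *)
- have head_in (x : T) s0 a : a \in edge_seq x s0 -> exists u, u \in a.
    elim: s0 x => //= y s0 IHs x; rewrite inE => /orP[/eqP->|/IHs//].
    by exists x.
  move=> i j i' j' a /andP[ij jm2] /andP[ij' jm2'] ha ha'.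
  have [u ua] := head_in _ _ _ ha.
  case: (ltnP j m) => jm.
    have aU := old_edges _ _ _ jm ij ha.
    case: (ltnP j' m) => jm'.
      apply: (pdisj i j i' j' a); rewrite ?ij ?ij' //.
        by move: ha; rewrite /p' jm b'U // (ltn_trans ij).
      by move: ha'; rewrite /p' jm' b'U // (ltn_trans ij').
    case: (ltnP i' m) => im'.
      have [u' [q [aE _ qnU _]]] := new_edges _ _ _ im' jm' ha'.
      by move: (aU q); rewrite aE set2r (negbTE qnU) => /(_ isT).
    have := last_edges i' j' a im' _ ha' u ua.
    by rewrite ij' jm2' aU // => /(_ isT).
  case: (ltnP i m) => im; last first.
    have aU : {in a, forall x, x \notin U}.
      by apply: (last_edges i j); rewrite ?ij.
    case: (ltnP j' m) => jm'.
      by have := aU u ua; rewrite (old_edges _ _ _ jm' ij' ha').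
    case: (ltnP i' m) => im'; last by clear -ij ij' jm2 jm2' im im'; lia.
    have [u' [q [aE u'U _ _]]] := new_edges _ _ _ im' jm' ha'.
    by move: (aU u'); rewrite aE set2l u'U => /(_ isT).
  have [{ua}u' [q [aE u'U qnU uq]]] := new_edges _ _ _ im jm ha.
  case: (ltnP j' m) => jm'.
    have := old_edges _ _ _ jm' ij' ha' q; rewrite aE set2r (negbTE qnU) => /(_ isT) //.
  case: (ltnP i' m) => im'; last first.
    have := last_edges i' j' a im' _ ha' u'; rewrite ij' jm2' aE set2l u'U.
    by move=> /(_ isT isT).
  have [u2 [q0 [aE' u2U q0nU uq']]] := new_edges _ _ _ im' jm' ha'.
  have [? ?] : u' = u2 /\ q = q0.
    move: aE'; rewrite aE => /eq_set2[] // [E _].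
    by move: q0nU; rewrite -E u'U.
  subst u2 q0.
  have fnb i0 j0 i1 : i0 < m -> m <= j0 -> ~~ e (b i0) (b' j0) -> i1 < m ->
      f (b i0) = b i1 -> False.
    move=> h0 hj hn h1 E; have [_ /AP[_ fb] _ _ _] := detour _ _ h0 hj hn.
    by have := fb _ h1; rewrite E eqxx.
  have jj : q = b' j \/ q = l (b i) /\ ~~ e (b i) (b' j).
    by case: uq => [[_ //]|[_ ? []]]; auto.
  have jj' : q = b' j' \/ q = l (b i') /\ ~~ e (b i') (b' j').
    by case: uq' => [[_ //]|[_ ? []]]; auto.
  have ii : i = i'.
    case: uq => [[E _]|[E n0 _]]; case: uq' => [[E' _]|[E' n0' _]].
    + by apply: binj; rewrite // -E.
    + by case: (fnb i' j' i); rewrite // -E.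
    + by case: (fnb i j i'); rewrite // -E.
    + have [P0 _ _ _ _] := detour _ _ im jm n0.
      have [P0' _ _ _ _] := detour _ _ im' jm' n0'.
      by apply: binj => //; apply: finj => //; rewrite -E.
  split=> //; subst i'.
  case: jj jj' => [E|[E n0]] [E'|[E' n0']].
  + by apply: b'inj => //; rewrite -E.
  + by case/eqP: (lb' (b i) j jm); rewrite -E'.
  + by case/eqP: (lb' (b i) j' jm'); rewrite -E.
  (* Both paths pass through the hub of [b i]; if [j] and [j'] differed, [b i] would miss both [q1]
     and [q3]. *)
  + have := missing13 (bU _ im); clear -n0 n0' jm jm' jm2 jm2' b'mE b'm1E b'm.
    case/b'm: jm2 (jm) n0 => [h|->|->] h'; first by rewrite leqNgt h in h'.
      case/b'm: jm2' (jm') n0' => [h0|->|->] // h0'; first by rewrite leqNgt h0 in h0'.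
      by rewrite b'mE b'm1E => /negbTE-> /negbTE->.
    case/b'm: jm2' (jm') n0' => [h0|->|->] // h0'; first by rewrite leqNgt h0 in h0'.
    by rewrite b'mE b'm1E => /negbTE-> /negbTE->.
Qed.

End Extension.

(** * Structure of edge-minimal graphs without stable triples *)

Lemma nonneighbours_clique (T : finType) (e : rel T) (V : {set T}) (v : T) :
    symmetric e -> alpha_le2 e V -> v \in V ->
  {in [set x in V | (x != v) && ~~ e x v] &, forall x y, x != y -> e x y}.
Proof.
move=> esym aV vV x y; rewrite !inE => /and3P[xV xv nx] /and3P[yV yv ny] xy.
by have := aV x y v xV yV vV xy xv yv; rewrite (negbTE nx) (negbTE ny) !orbF.
Qed.

(** Fix [v]. If its closed neighbourhood is a clique, this clique and that of the nonneighbours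
    cover [V], and the larger one has at least half of the vertices. Otherwise [v] has nonadjacent
    neighbours [x] and [z]; take [u] missing [x] and [v], and [w] missing [z] and [v]. The absence
    of stable triples forces the remaining edges of the induced cycle [x w u z v]. *)
Lemma induced_C5_or_clique (T : finType) (e : rel T) (V : {set T}) :
    symmetric e -> alpha_le2 e V ->
    (forall x y, x \in V -> y \in V -> x != y -> e x y ->
       exists z, [/\ z \in V, z != x, z != y, ~~ e x z & ~~ e y z]) ->
  (exists q1 q2 q3 q4 q5, {subset [:: q1; q2; q3; q4; q5] <= V} /\
     induced_C5 e q1 q2 q3 q4 q5) \/
  exists K : {set T}, [/\ K \subset V, #|V| <= 2 * #|K|
    & {in K &, forall x y, x != y -> e x y}].
Proof.
move=> esym aV maxV.
case: (set_0Vmem V) => [->|[v vV]].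
  right; exists set0; rewrite sub0set cards0; split=> // x y.
  by rewrite inE.
pose N := [set x in V | (x == v) || e x v].
pose N' := [set x in V | (x != v) && ~~ e x v].
have cN : #|V| = #|N| + #|N'|.
  rewrite -(cardsID N V); congr (_ + _); apply: eq_card => z.
    by rewrite !inE andbA andbb.
  by rewrite !inE; case: (z \in V); rewrite ?andbF //= negb_or andbT.
have [hN|] := boolP [forall x in N, forall y in N, (x != y) ==> e x y].
  right; case: (leqP #|N| #|N'|) => hc.
    exists N'; split; first by apply/subsetP=> x; rewrite inE => /andP[].
      lia.
    exact: nonneighbours_clique.
  exists N; split; first by apply/subsetP=> x; rewrite inE => /andP[].
    lia.
  by move=> x y xN yN; move/forall_inP: hN => /(_ x xN)/forall_inP/(_ y yN)/implyP.
case/forall_inPn=> x xN /forall_inPn[z zN]; rewrite negb_imply => /andP[xz nxz]; left.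
have xv : x != v.
  by apply: contraTneq zN => E; rewrite inE -E eq_sym (negbTE xz) esym (negbTE nxz) andbF.
have zv : z != v.
  by apply: contraTneq xN => E; rewrite inE -E (negbTE xz) (negbTE nxz) andbF.
have exv : e x v by move: xN; rewrite inE (negbTE xv) => /andP[].
have ezv : e z v by move: zN; rewrite inE (negbTE zv) => /andP[].
have [xV zV] : x \in V /\ z \in V by move: xN zN; rewrite !inE => /andP[-> _] /andP[-> _].
have [u [uV ux uv nxu nvu]] := maxV _ _ xV vV xv exv.
have [w [wV wz wv nzw nvw]] := maxV _ _ zV vV zv ezv.
have uz : u != z by apply: contraNneq nvu => ->; rewrite esym.
have wx : w != x by apply: contraNneq nvw => ->; rewrite esym.
have uw : u != w.
  have := aV x z u xV zV uV xz; rewrite eq_sym ux eq_sym uz => /(_ isT isT).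
  by rewrite (negbTE nxz) (negbTE nxu) /=; apply: contraTneq => ->.
have e1 : e x w.
  have := aV x z w xV zV wV xz; rewrite eq_sym wx eq_sym wz => /(_ isT isT).
  by rewrite (negbTE nxz) (negbTE nzw) orbF.
have e2 : e w u.
  have := aV w v u wV vV uV wv; rewrite eq_sym uw eq_sym uv => /(_ isT isT).
  by rewrite (esym w v) (negbTE nvw) (negbTE nvu) orbF.
have e3 : e u z.
  have := aV u z x uV zV xV uz ux; rewrite eq_sym xz => /(_ isT).
  by rewrite (esym z x) (esym u x) (negbTE nxz) (negbTE nxu) !orbF.
exists x, w, u, z, v; split.
  by move=> t; rewrite !inE => /or4P[|||/orP[]]/eqP->.
rewrite /induced_C5 e1 e2 e3 ezv nxu nvw esym exv (esym w z) nzw (esym u v) nvu.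
rewrite (esym z x) nxz /= !inE !negb_or uz uv wz wv zv xz xv.
by rewrite (eq_sym x w) wx (eq_sym x u) ux (eq_sym w u) uw.
Qed.

(** A stable triple created by deleting [xy] would consist of [x], [y] and a vertex adjacent to
    neither. *)
Lemma alpha_le2_delete (T : finType) (e : rel T) (V : {set T}) (x y : T) :
    symmetric e -> alpha_le2 e V ->
    (forall z, z \in V -> z != x -> z != y -> e x z || e y z) ->
  alpha_le2 (fun a b => e a b && ([set a; b] != [set x; y])) V.
Proof.
move=> esym aV h.
pose e' a b := e a b && ([set a; b] != [set x; y]).
have e'sym : symmetric e' by move=> a b; rewrite /e' esym setUC.
(* If [ab] is the deleted edge, then [c] is not on it, so the edges at [c] survive and the
   assumption on [xy] applies to [c]. *)
have third a b c : a \in V -> b \in V -> c \in V -> a != b -> a != c -> b != c ->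
    e a b -> [|| e' a b, e' a c | e' b c].
  move=> aV' bV cV ab ac bc eab; rewrite {1}/e' eab /=.
  case: eqP => //= E; have cx : c \notin [set x; y].
    by rewrite -E !inE negb_or eq_sym ac eq_sym bc.
  have e'c t : e' t c = e t c.
    by rewrite /e' [_ != _](_ : _ = true) ?andbT //; apply: contraNneq cx => <-;
      rewrite !inE eqxx orbT.
  rewrite !e'c; move: cx; rewrite !inE negb_or => /andP[cx cy].
  by have := h c cV cx cy; case/eq_set2: E => [[-> ->]|[-> ->]] //; rewrite orbC.
move=> a b c aV' bV cV ab ac bc; rewrite -/(e' a b) -/(e' a c) -/(e' b c).
case/or3P: (aV a b c aV' bV cV ab ac bc) => E.
- exact: third.
- have := third a c b aV' cV bV ac ab; rewrite eq_sym bc (e'sym c b) => /(_ isT E).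
  by rewrite orbCA.
- have := third b c a bV cV aV' bc; rewrite eq_sym ab eq_sym ac => /(_ isT isT E).
  by rewrite (e'sym b a) (e'sym c a); case: (e' a b); case: (e' a c); case: (e' b c).
Qed.

Lemma alpha_le2_sub (T : finType) (e : rel T) (U V : {set T}) :
  U \subset V -> alpha_le2 e V -> alpha_le2 e U.
Proof.
by move=> /subsetP UV aV x y z /UV xV /UV yV /UV zV; apply: aV.
Qed.

(** * Choosing the rotation of the 5-cycle *)

Lemma clique_immersion_C5 (T : finType) (e : rel T) (V : {set T})
    (q1 q2 q3 q4 q5 : T) (k : nat) :
    symmetric e -> alpha_le2 e V -> {subset [:: q1; q2; q3; q4; q5] <= V} ->
    induced_C5 e q1 q2 q3 q4 q5 ->
    {in V, forall v, #|[set x in V | (x != v) && ~~ e x v]| <= (2 * k).+1} ->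
    5 * k.+1 <= #|V| ->
    (5 * k <= #|V :\: [set x in [:: q1; q2; q3; q4; q5]]| ->
     has_clique_immersion e (V :\: [set x in [:: q1; q2; q3; q4; q5]]) (2 * k)) ->
  has_clique_immersion e V (2 * k.+1).
Proof.
move=> esym aV qV C5 degV cV; set U := V :\: _ => hU.
have cU : 5 * k <= #|U|.
  have := cardsID [set x in [:: q1; q2; q3; q4; q5]] V; rewrite -/U.
  have := leq_trans (subset_leq_card (subsetIr V [set x in [:: q1; q2; q3; q4; q5]])).
  move=> /(_ 5); rewrite cardsE card_size => /(_ isT); lia.
have [b [p imm]] := hU cU.
have UV : U \subset V by apply: subsetDl.
have UE z : (z \in U) = (z \notin [:: q1; q2; q3; q4; q5]) && (z \in V).
  by rewrite in_setD inE.
pose M := [set b i | i : 'I_(2 * k)].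
pose A x y := [set z in U | (z \notin M) && (e z x || e z y)].
have ext r1 r2 r3 r4 r5 : [:: r1; r2; r3; r4; r5] =i [:: q1; q2; q3; q4; q5] ->
    induced_C5 e r1 r2 r3 r4 r5 -> 2 * k <= #|A r4 r5| ->
    has_clique_immersion e V (2 * k.+1).
  move=> rq C5r cA; rewrite mulnS add2n.
  have rV : {subset [:: r1; r2; r3; r4; r5] <= V} by move=> x; rewrite rq => /qV.
  have rU : {in [:: r1; r2; r3; r4; r5], forall x, x \notin U}.
    by move=> x; rewrite rq => xq; rewrite UE xq.
  (* The nonneighbour [y] of [x] lies outside [U], which lowers the bound [2k + 1] on nonneighbours
     to the required [2k] inside [U]. *)
  have bound x y : x \in [:: r1; r2; r3; r4; r5] -> y \in [:: r1; r2; r3; r4; r5] ->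
      y != x -> ~~ e y x -> #|[set z in U | ~~ e z x]| <= #|A r4 r5|.
    move=> xr yr yx nyx; apply: leq_trans cA; rewrite -ltnS.
    apply: leq_trans (degV x (rV _ xr)); apply: proper_card; apply/properP; split.
      apply/subsetP=> z; rewrite 2!in_set => /andP[zU nzx].
      apply/and3P; split=> //; first exact: (subsetP UV).
      by apply: contraTneq zU => ->; apply: rU.
    exists y; first by rewrite inE rV // yx.
    by rewrite inE (negbTE (rU _ yr)).
  have /and3P[u _ /and5P[n13 _ _ _ _]] := C5r.
  have d13 : r1 != r3 by apply: contraTneq u => <-; rewrite /= !inE eqxx orbT.
  apply: (clique_immersion_extend esym aV UV rV rU C5r imm) => //.
    by apply: (bound r1 r3); rewrite ?inE ?eqxx ?orbT // 1?eq_sym // esym.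
  by apply: (bound r3 r1); rewrite ?inE ?eqxx ?orbT.
case: (leqP (2 * k) #|A q4 q5|) => [|h45]; first exact: ext.
have rotE (r1 r2 r3 r4 r5 : T) : [:: r2; r3; r4; r5; r1] =i [:: r1; r2; r3; r4; r5].
  exact: (mem_rot 1 [:: r1; r2; r3; r4; r5]).
have C5' := induced_C5_rot C5.
case: (leqP (2 * k) #|A q5 q1|) => [|h51]; first exact: ext.
case: (leqP (2 * k) #|A q1 q2|) => [|h12].
  by apply: ext (induced_C5_rot C5') => x; rewrite (rotE q2) (rotE q1).
pose B x y := [set z in U | (z \notin M) && ~~ (e z x || e z y)].
have BE z x y : (z \in B x y) = [&& z \in U, z \notin M & ~~ (e z x || e z y)].
  by rewrite in_set.
have cAB x y : #|A x y| + #|B x y| = #|U :\: M|.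
  rewrite -(cardsID (A x y) (U :\: M)); congr (_ + _); apply: eq_card => z.
    rewrite in_setI in_setD [z \in A x y]in_set.
    by case: (z \in U); case: (z \in M); case: (_ || _).
  rewrite in_setD in_setD [z \in A x y]in_set BE.
  by case: (z \in U); case: (z \in M); case: (_ || _).
have cM : #|U| <= #|U :\: M| + 2 * k.
  have := cardsID M U; have := subset_leq_card (subsetIr U M).
  have : #|M| <= 2 * k by apply: leq_trans (leq_imset_card _ _) _; rewrite card_ord.
  clear; lia.
have miss z x y : z \in U -> x \in [:: q1; q2; q3; q4; q5] ->
    y \in [:: q1; q2; q3; q4; q5] -> x != y -> ~~ e x y -> e z x || e z y.
  move=> zU xq yq xy nxy; have zV := subsetP UV _ zU.
  have := aV z x y zV (qV _ xq) (qV _ yq); rewrite (negbTE nxy) orbF; apply=> //.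
    by apply: contraTneq zU => ->; rewrite UE xq.
  by apply: contraTneq zU => ->; rewrite UE yq.
have /and3P[u _ /and5P[_ _ _ n41 n52]] := C5.
have d41 : q4 != q1 by apply: contraTneq u => <-; rewrite /= !inE eqxx !orbT.
have d52 : q5 != q2 by apply: contraTneq u => <-; rewrite /= !inE eqxx !orbT andbF.
have z41 z : z \in U -> e z q4 || e z q1.
  by move=> zU; apply: (miss z _ _ zU); rewrite ?inE ?eqxx ?orbT.
have z52 z : z \in U -> e z q5 || e z q2.
  by move=> zU; apply: (miss z _ _ zU); rewrite ?inE ?eqxx ?orbT.
(* The sets are disjoint: a vertex in two of them would miss both ends of the nonedge [q4 q1] or of
   [q5 q2]. *)
have cB : #|B q4 q5| + #|B q5 q1| + #|B q1 q2| <= #|U :\: M|.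
  have d1 : B q4 q5 :&: B q5 q1 = set0.
    apply/setP=> z; rewrite in_set0 in_setI !BE.
    have [zU|] := boolP (z \in U) => //=; move: (z41 z zU).
    by case: (z \in M); case: (e z q4); case: (e z q1); rewrite ?orbT ?andbF.
  have d2 : (B q4 q5 :|: B q5 q1) :&: B q1 q2 = set0.
    apply/setP=> z; rewrite in_set0 in_setI in_setU !BE.
    have [zU|] := boolP (z \in U) => //=; move: (z41 z zU) (z52 z zU).
    case: (z \in M); case: (e z q4); case: (e z q1);
      by case: (e z q5); case: (e z q2).
  rewrite -(cardsUI (B q4 q5)) d1 cards0 addn0 -cardsUI d2 cards0 addn0.
  apply: subset_leq_card; apply/subsetP=> z.
  rewrite 2!in_setU !BE in_setD -orbA.
  by case/or3P=> /and3P[-> ->].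
(* If all three candidate sets had fewer than [2k] elements, adding up would give
   [2 * #|U :\: M| < 6k], against [#|U :\: M| >= 5k - 2k]. *)
have := cAB q4 q5; have := cAB q5 q1; have := cAB q1 q2.
clear -h45 h51 h12 cB cM cU; lia.
Qed.

(** * The induction *)

Lemma clique_immersion_alpha_le2 (T : finType) (e : rel T) (V : {set T}) (k : nat) :
    0 < #|T| -> symmetric e -> alpha_le2 e V -> 5 * k <= #|V| ->
  has_clique_immersion e V (2 * k).
Proof.
move=> T0; elim: k e V => [|k IHk] e V.
  move=> _ _ _; apply: (@clique_immersion_of_clique _ _ _ set0) => //.
    exact: sub0set.
  by move=> x y; rewrite inE.
(* Inner induction on the number of ordered adjacent pairs replaces the choice of an edge-minimal
   graph. *)
have [c] := ubnP #|[set ab | e ab.1 ab.2]|.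
elim: c e => // c IHc e; rewrite ltnS => ec esym aV cV.
have [/existsP[x /existsP[y /andP[exy /forall_inP h]]]|maxV] := boolP
  [exists x, exists y, e x y && [forall z in V, (z != x) ==> (z != y) ==> (e x z || e y z)]].
  apply: (@clique_immersion_sub _ (fun a b => e a b && ([set a; b] != [set x; y]))).
    by move=> a b /andP[].
  apply: IHc => //.
  - apply: leq_trans ec; apply: proper_card; apply/properP; split.
      by apply/subsetP=> ab; rewrite !inE => /andP[].
    by exists (x, y); rewrite !inE //= eqxx andbF.
  - by move=> a b; rewrite esym setUC.
  - by apply: alpha_le2_delete => // z zV zx zy; have := h z zV; rewrite zx zy.
have [|[q1 [q2 [q3 [q4 [q5 [qV C5]]]]]]|[K [KV cK eK]]] := induced_C5_or_clique esym aV.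
- move=> x y _ _ _ exy; move/existsPn: maxV => /(_ x)/existsPn/(_ y); rewrite exy /=.
  case/forall_inPn=> z zV; rewrite !negb_imply negb_or => /and3P[zx zy /andP[nx ny]].
  by exists z.
- have [/exists_inP[v vV dv]|/exists_inPn small] := boolP
    [exists v in V, 2 * k.+1 <= #|[set x in V | (x != v) && ~~ e x v]|].
    apply: clique_immersion_of_clique dv _ => //.
      by apply/subsetP=> x; rewrite inE => /andP[].
    exact: nonneighbours_clique.
  apply: (clique_immersion_C5 esym aV qV C5) => //.
    by move=> v /small; rewrite -ltnNge mulnS.
  by move=> cU; apply: IHk => //; apply: alpha_le2_sub aV; apply: subsetDl.
(* Half of [5(k + 1)] is at least [2(k + 1)]. *)
- apply: clique_immersion_of_clique KV _ eK => //; lia.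
Qed.

(** * Transfer to unordered edges and strong immersions *)

Theorem theorem1p6 (n : nat) (hn : 1 <= n) (G : sgraph) (hG : #|G| = n)
    (hS : ~ exists S : {set G}, stable S /\ #|S| = 3) :
  has_strong_immersion (complete (2 * (n %/ 5))) G.
Proof.
have aG : alpha_le2 (@adj G) [set: G].
  move=> x y z _ _ _ xy xz yz; apply/negPn/negP; rewrite !negb_or => /and3P[nxy nxz nyz].
  apply: hS; exists [set x; y; z]; split; last first.
    by rewrite setUC cardsU1 cards2 xy !inE negb_or eq_sym xz eq_sym yz.
  apply/forall_inP=> a aS; apply/forall_inP=> b; move: aS.
  rewrite !inE -!orbA => /or3P[]/eqP-> /or3P[]/eqP->;
  by rewrite ?adj_irr // adj_sym.
have [||b [p [binj _ pP pdisj]]] :=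
  @clique_immersion_alpha_le2 G (@adj G) [set: G] (n %/ 5) _ (@adj_sym G) aG.
- by rewrite hG.
- by rewrite cardsT hG; lia.
set m := 2 * (n %/ 5) in binj pP pdisj *.
(* An unordered edge is read in its increasing orientation, the only one for which [p] is
   specified. *)
pose pi2 (E : {set 'I_m}) := if [pick ij : 'I_m * 'I_m | (ij.1 < ij.2) &&
  (E == [set ij.1; ij.2])] is Some ij then b ij.1 :: p ij.1 ij.2 else [::].
have pi2P E : E \in edges (complete m) -> exists i j : 'I_m,
    [/\ i < j, E = [set i; j] & pi2 E = b i :: p i j].
  case/imset2P=> i j _; rewrite inE /= => ij EE; rewrite /pi2.
  case: pickP => [[i' j'] /andP[/= ij' /eqP EE']|]; first by exists i', j'.
  have := ij; rewrite /complete_rel -val_eqE /= neq_ltn.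
  case/orP=> lt_ij; first by move/(_ (i, j)); rewrite /= lt_ij EE eqxx.
  by move/(_ (j, i)); rewrite /= lt_ij EE setUC eqxx.
pose pi1 (i : complete m) : G := b i.
have pi1E (i j : 'I_m) : pi1 @: [set i; j] = [set b i; b j].
  by rewrite imsetU1 imset_set1.
have inm (i j : 'I_m) : i < j -> i < j < m by move=> ->; rewrite ltn_ord.
exists pi1, pi2; split; first split.
- by move=> i j /binj ij; apply/val_inj/ij; rewrite inE ltn_ord.
- move=> E /pi2P[i [j [ij -> ->]]]; rewrite pi1E /is_path.
  by have [-> -> -> _ _] := pP i j (inm i j ij); rewrite eqxx.
- move=> E F /pi2P[i [j [ij -> ->]]] /pi2P[i' [j' [ij' -> ->]]] EF a a1.
  apply: contra_neqN EF => a2.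
  by have [/val_inj-> /val_inj->] := pdisj _ _ _ _ _ (inm _ _ ij) (inm _ _ ij') a1 a2.
- move=> E /pi2P[i [j [ij -> ->]]] v vp /codomP[r vr]; rewrite pi1E vr !inE /pi1.
  have [_ _ _ _ /(_ r (ltn_ord r))] := pP i j (inm i j ij).
  by move: vp; rewrite vr => /[swap]/[apply] -[]->; rewrite eqxx ?orbT.
Qed.
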